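(* Let $P\subset\mathbb{R}^d$ be a simple $d$-dimensional polytope with facets $\sigma_1,\dots,\sigma_N$, and let $q_1,\dots,q_N\in\mathbb{C}$ be arbitrary weights assigned to these facets. Then, as functions on $\mathbb{R}^d$, $$\mathbf 1^w_P=\sum_{F\preceq P}(-1)^{\dim F}\,\mathbf 1^w_{\mathbf C_F},$$ where the sum runs over all nonempty faces $F$ of $P$ (including $F=P$, for which $\mathbf C_P=\mathbb{R}^d$ and $\mathbf 1^w_{\mathbf C_P}\equiv 1$).
   Context: A $d$-dimensional polyhedron $Q\subset\mathbb{R}^d$ is written irredundantly as $Q=H_1\cap\dots\cap H_N$ with $H_i=\{x:\langle u_i,x\rangle+\mu_i\ge 0\}$, $u_i\in(\mathbb{R}^d)^*$, $\mu_i\in\mathbb{R}$, $N$ minimal; its facets are $\sigma_i=Q\cap\partial H_i$. A polytope is a bounded polyhedron. $P$ is simple if every vertex lies in exactly $d$ facets. For a nonempty face $F$ of $P$, $I_F$ denotes the set of indices $i$ with $F\subseteq\sigma_i$ (so $F=\bigcap_{i\in I_F}\sigma_i$ for proper faces, and $I_P=\emptyset$). Weighted characteristic function: given complex weights $q_i$ on the facets $\sigma_i$ of a polyhedron $Q$, define $\mathbf 1^w_Q:\mathbb{R}^d\to\mathbb{C}$ by $\mathbf 1^w_Q(x)=0$ if $x\notin Q$, and $\mathbf 1^w_Q(x)=\prod_{i\in I_F}q_i$ if $x\in Q$, where $F$ is the smallest face of $Q$ containing $x$ (equivalently the product of $q_i$ over those facets containing $x$; it equals $1$ for $x$ in the interior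 of $Q$). Tangent cone: for a face $F$ of $P$, $\mathbf C_F=\{y+r(x-y): r\ge 0,\ y\in F,\ x\in P\}$. It is the polyhedron $\bigcap_{i\in I_F}H_i$, whose facets are $\mathbf C_F\cap\partial H_i$ for $i\in I_F$; the facet $\mathbf C_F\cap\partial H_i$ is given the same weight $q_i$ as $\sigma_i$, and $\mathbf 1^w_{\mathbf C_F}$ is the weighted characteristic function of $\mathbf C_F$ with these weights. *)

(* Defs.v *)
From HB Require Import structures.
From mathcomp Require Import all_boot all_order all_algebra.
From mathcomp Require Import boolp classical_sets reals.
From mathcomp Require Import complex.
Set Implicit Arguments. Unset Strict Implicit. Unset Printing Implicit Defensive.
Import Order.TTheory GRing.Theory Num.Theory.
Local Open Scope ring_scope.
Local Open Scope classical_set_scope.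

Section Polytopes.
Variables (R : realType) (d N : nat).
Variables (u : 'I_N -> 'rV[R]_d) (mu : 'I_N -> R).

Definition pair (v x : 'rV[R]_d) : R := \sum_(j < d) v 0 j * x 0 j.

Definition ell (i : 'I_N) (x : 'rV[R]_d) : R := pair (u i) x + mu i.

Definition halfsp (i : 'I_N) : set 'rV[R]_d := [set x | 0 <= ell i x].
Definition polyhedron (I : {set 'I_N}) : set 'rV[R]_d :=
  [set x | forall i, i \in I -> 0 <= ell i x].
Definition P : set 'rV[R]_d := polyhedron [set: 'I_N]%SET.

Definition facet (i : 'I_N) : set 'rV[R]_d := [set x | P x /\ ell i x = 0].

Definition aff_indep_pts (F : set 'rV[R]_d) (k : nat) : Prop :=
  exists (p0 : 'rV[R]_d) (p : 'I_k -> 'rV[R]_d),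
    F p0 /\ (forall j, F (p j)) /\ row_free (\matrix_(j < k) (p j - p0)).
Definition affdim (F : set 'rV[R]_d) : nat :=
  \max_(k < d.+1 | `[< aff_indep_pts F k >]) k.

Definition is_face (F : set 'rV[R]_d) : Prop :=
  F !=set0 /\
  (F = P \/ exists (c : 'rV[R]_d) (b : R),
      (forall x, P x -> pair c x <= b) /\ F = [set x | P x /\ pair c x = b]).

Definition Iof (F : set 'rV[R]_d) : {set 'I_N} :=
  [set i | `[< F `<=` facet i >]]%SET.

(* the face determined by an index set: P /\ bigcap_{i in I} boundary H_i
   (= bigcap_{i in I_F} sigma_i for a proper face F, = P for I = set0) *)
Definition face_of_idx (I : {set 'I_N}) : set 'rV[R]_d :=
  [set x | P x /\ forall i, i \in I -> ell i x = 0].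

Definition bounded_set (S : set 'rV[R]_d) : Prop :=
  exists M : R, forall x, S x -> forall j, `|x 0 j| <= M.
Definition irredundant : Prop :=
  forall j : 'I_N, polyhedron [set~ j]%SET <> P.
Definition full_dim : Prop := P !=set0 /\ affdim P = d.
Definition simple_polytope : Prop :=
  forall F, is_face F -> affdim F = 0%N -> #|Iof F| = d.

Variable q : 'I_N -> complex R.
Definition wchar (I : {set 'I_N}) (x : 'rV[R]_d) : complex R :=
  if `[< polyhedron I x >] then \prod_(i in I | ell i x == 0) q i else 0.

Definition wcharP (x : 'rV[R]_d) : complex R := wchar [set: 'I_N]%SET x.
Definition wcharC (F : set 'rV[R]_d) (x : 'rV[R]_d) : complex R := wchar (Iof F) x.

End Polytopes.

(* Main.v *)
Require Import Defs.
From HB Require Import structures.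
From mathcomp Require Import all_boot all_order all_algebra.
From mathcomp Require Import boolp classical_sets reals complex.
From mathcomp Require Import ring lra.
Import Order.TTheory GRing.Theory Num.Theory.
Local Open Scope ring_scope.
Local Open Scope classical_set_scope.

(** Only vertices matter.  Since [P] is simple, the facet normals at a vertex [v] form a
    basis, with dual basis the edge directions [e_i] out of [v], and the faces containing [v]
    correspond to the subsets of [tight v].  Fix [xi] not constant on any edge and attach each
    face [F_I] to its unique [xi]-maximal vertex: the faces attached to [v] are those with
    [ascents xi v <= I <= tight v].  With [w_i] equal to 0, [q_i] or 1 according to the sign
    of [ell_i x], the sum over these faces factors as
      [\prod_(i in ascents) w_i * \prod_(i in tight \ ascents) (w_i - 1)].
    If this is nonzero then [ell_i x >= 0] on the ascents and [ell_i x <= 0] on the other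
    tight indices, so expanding [x - v] in the [e_i] gives [xi v <= xi x].  Now take [xi] to be
    a generic small perturbation of the sum of the [u_i] over [ell_i x <= 0].  If [x] is not
    in [P], then [xi x < xi v] at every vertex and all terms vanish.  If [x] is in [P], only
    vertices of the smallest face containing [x] can contribute, and among them only the
    [xi]-minimal vertex of [P] does, with the product of the [q_i] over the facets through
    [x]. *)

(** Distributing the product of [F i + G i] over all [i] gives one term per subset [J]. Since [G]
    vanishes on [U] and [F] vanishes off [W], only the [J] between [U] and [W] survive. *)
Lemma sum_interval_prod {A : comNzRingType} {T : finType} (U W : {set T}) (w : T -> A) :
  U \subset W ->
  \sum_(I : {set T} | (U \subset I) && (I \subset W))
     (-1) ^+ #|W :\: I| * \prod_(i in I) w i =
  \prod_(i in U) w i * \prod_(i in W :\: U) (w i - 1).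
Proof.
move=> UW.
pose F i := if i \in W then w i else 0.
pose G i : A := if i \in U then 0 else if i \in W then -1 else 1.
transitivity (\prod_i (F i + G i)); last first.
  rewrite [X in X * _]big_mkcond [X in _ * X]big_mkcond -big_split/=.
  apply: eq_bigr => i _; rewrite /F /G inE.
  have [iU|iU] := boolP (i \in U); first by rewrite (fintype.subsetP UW)//= addr0 mulr1.
  by case: ifP => _ /=; rewrite ?mul1r ?add0r.
rewrite bigA_distr big_mkcond; apply: eq_bigr => J _.
case: ifP => [/andP[UJ JW]|/negbT].
  rewrite -prodr_const [X in X * _]big_mkcond [X in _ * X]big_mkcond -big_split/=.
  apply: eq_bigr => i _; rewrite /F /G inE.
  have [iJ|iJ] := boolP (i \in J); first by rewrite (fintype.subsetP JW)//= mul1r.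
  have -> : (i \in U) = false by apply: contraNF iJ => /(fintype.subsetP UJ).
  by case: ifP => _; rewrite mulr1.
rewrite negb_and => /orP[] /fintype.subsetPn[i i1 i2]; rewrite (bigD1 i)//=.
  by rewrite (negPf i2) /G i1 mul0r.
by rewrite i1 /F (negPf i2) mul0r.
Qed.

(** * The bilinear pairing and small generic perturbations *)

Section Pairing.
Context {R : realType} {d : nat}.
Implicit Types v w x y : 'rV[R]_d.

Lemma pairC v x : pair v x = pair x v.
Proof. by apply: eq_bigr => j _; rewrite mulrC. Qed.

Lemma pairDr v x y : pair v (x + y) = pair v x + pair v y.
Proof. by rewrite /pair -big_split; apply: eq_bigr => j _; rewrite mxE mulrDr. Qed.

Lemma pairZr v a x : pair v (a *: x) = a * pair v x.
Proof. by rewrite /pair mulr_sumr; apply: eq_bigr => j _; rewrite mxE mulrCA. Qed.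

Lemma pair0r v : pair v 0 = 0.
Proof. by rewrite /pair big1// => j _; rewrite mxE mulr0. Qed.

Lemma pairNr v x : pair v (- x) = - pair v x.
Proof. by rewrite -scaleN1r pairZr mulN1r. Qed.

Lemma pairBr v x y : pair v (x - y) = pair v x - pair v y.
Proof. by rewrite pairDr pairNr. Qed.

Lemma pairDl v w x : pair (v + w) x = pair v x + pair w x.
Proof. by rewrite !(pairC _ x) pairDr. Qed.

Lemma pairZl v a x : pair (a *: v) x = a * pair v x.
Proof. by rewrite !(pairC _ x) pairZr. Qed.

Lemma pairNl v x : pair (- v) x = - pair v x.
Proof. by rewrite !(pairC _ x) pairNr. Qed.

Lemma pair_sumr (I : finType) (A : pred I) v (f : I -> 'rV[R]_d) :
  pair v (\sum_(i | A i) f i) = \sum_(i | A i) pair v (f i).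
Proof. by rewrite (big_morph _ (pairDr v) (pair0r v)). Qed.

Lemma pair_suml (I : finType) (A : pred I) (f : I -> 'rV[R]_d) x :
  pair (\sum_(i | A i) f i) x = \sum_(i | A i) pair (f i) x.
Proof. by rewrite pairC pair_sumr; apply: eq_bigr => i _; rewrite pairC. Qed.

Lemma pair_delta j x : pair (delta_mx 0 j) x = x 0 j.
Proof.
rewrite /pair (bigD1 j)//= mxE !eqxx mul1r big1 ?addr0// => k kj.
by rewrite mxE (negPf kj) mul0r.
Qed.

Lemma mulmx_tr_pair n (A : 'M[R]_(n, d)) x i : (x *m A^T) 0 i = pair (row i A) x.
Proof. by rewrite mxE; apply: eq_bigr => j _; rewrite !mxE mulrC. Qed.

Lemma small_step {T : eqType} (s : seq T) (a b : T -> R) :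
  exists2 e : R, 0 < e & forall m, 0 < m <= e -> forall i, i \in s ->
    (0 < a i -> 0 < a i + m * b i) /\ (a i < 0 -> a i + m * b i < 0).
Proof.
elim: s => [|i s [e e0 IH]]; first by exists 1.
have [e' e'0 He'] : exists2 e' : R, 0 < e' & a i != 0 -> e' * `|b i| < `|a i|.
  have [ai|ai] := eqVneq (a i) 0; first by exists 1.
  (* The [+ 1] keeps the denominator positive when [b i = 0] and makes the bound strict. *)
  exists (`|a i| / (`|b i| + 1)).
    by rewrite divr_gt0 ?normr_gt0// ltr_pwDr.
  move=> _; rewrite mulrAC ltr_pdivrMr ?ltr_pwDr//.
  by rewrite ltr_pM2l ?normr_gt0// ltrDl.
exists (Num.min e e'); first by rewrite lt_min e0.
move=> m /andP[m0]; rewrite le_min => /andP[me me'] k.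
rewrite inE => /orP[/eqP->|]; last by apply: IH; rewrite m0.
have [->|ai] := eqVneq (a i) 0; first by rewrite ltxx.
have H : `|m * b i| < `|a i|.
  by rewrite normrM (gtr0_norm m0) (le_lt_trans _ (He' ai))// ler_wpM2r.
split=> a0; move: H; rewrite ltr_norml => /andP[].
  by rewrite (gtr0_norm a0) => ? _; lra.
by rewrite (ltr0_norm a0) => _ ?; lra.
Qed.

(** Coordinates are treated one at a time: a small multiple of [delta_mx 0 j] makes the pairing
    nonzero on vectors where it vanished and whose [j]-th coordinate is nonzero, while [small_step]
    preserves the signs already obtained. *)
Lemma generic_perturbation (s : seq 'rV[R]_d) (xi0 : 'rV[R]_d) :
  exists xi : 'rV[R]_d, forall e, e \in s ->
    (e != 0 -> pair xi e != 0) /\ (0 < pair xi0 e -> 0 < pair xi e).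
Proof.
suff [xi H] : exists xi : 'rV[R]_d, forall e, e \in s ->
    (forall j, j \in enum 'I_d -> e 0 j != 0 -> pair xi e != 0) /\
    (0 < pair xi0 e -> 0 < pair xi e).
  exists xi => e /H[H1 H2]; split=> // e0.
  have [j ej|e0'] := pickP (fun j => e 0 j != 0); first by rewrite (H1 j) ?mem_enum.
  case/eqP: e0; apply/rowP => j; rewrite mxE; apply/eqP.
  by have := e0' j => /negbT; rewrite negbK.
elim: (enum _) => [|j t [xi IH]]; first by exists xi0.
have [e e0 He] := small_step s (pair xi) (fun y => y 0 j).
exists (xi + e *: delta_mx 0 j) => y ys.
have [|H1 H2] := He e _ _ ys; first by rewrite e0 lexx.
have [I1 I2] := IH _ ys.
rewrite pairDl pairZl pair_delta; split=> [k|/I2/H1//].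
have [xy|xy|xy] := ltgtP (pair xi y) 0.
- by move=> _ _; rewrite lt_eqF ?H2.
- by move=> _ _; rewrite gt_eqF ?H1.
rewrite xy add0r mulf_eq0 (gt_eqF e0)/= inE => /orP[/eqP->//|kt yk].
by have := I1 _ kt yk; rewrite xy eqxx.
Qed.

End Pairing.

(** * Feasible directions and vertices of a bounded polyhedron *)

Section SimplePolytope.
Context {R : realType} {d N : nat}.
Variables (u : 'I_N -> 'rV[R]_d) (mu : 'I_N -> R).
Local Notation ell := (ell u mu).
Local Notation P := (P u mu).
Local Notation face_of_idx := (face_of_idx u mu).

Definition tight (x : 'rV[R]_d) : {set 'I_N} := [set i | ell i x == 0]%SET.

(** Extreme points in algebraic form: the normals tight at [v] span the whole space. *)
Definition is_vertex (v : 'rV[R]_d) : Prop :=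
  P v /\ forall y, (forall i, i \in tight v -> pair (u i) y = 0) -> y = 0.

Lemma ellD i x y : ell i (x + y) = ell i x + pair (u i) y.
Proof. by rewrite /Defs.ell pairDr addrAC. Qed.

Lemma ellB i x y : ell i x - ell i y = pair (u i) (x - y).
Proof. by rewrite /Defs.ell pairBr; ring. Qed.

Lemma P_ge0 {x} i : P x -> 0 <= ell i x.
Proof. by move=> Px; apply: Px; rewrite inE. Qed.

Lemma mem_P x : (forall i, 0 <= ell i x) -> P x.
Proof. by move=> H i _. Qed.

Lemma tight_gt0 {x i} : P x -> i \notin tight x -> 0 < ell i x.
Proof. by move=> Px; rewrite inE => xi; rewrite lt_def xi P_ge0. Qed.

Lemma tight0 {x i} : i \in tight x -> ell i x = 0.
Proof. by rewrite inE => /eqP. Qed.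

Lemma face_of_idx_tight I x : face_of_idx I x <-> P x /\ I \subset tight x.
Proof.
split=> -[Px H]; split=> //.
  by apply/fintype.subsetP => i /H; rewrite inE => /eqP.
by move=> i /(fintype.subsetP H); apply: tight0.
Qed.

Lemma feasible_step v y : P v ->
  (forall i, i \in tight v -> 0 <= pair (u i) y) ->
  exists2 e : R, 0 < e & P (v + e *: y).
Proof.
move=> Pv Hy; have [e e0 He] := small_step (enum 'I_N) (ell^~ v) (fun i => pair (u i) y).
exists e => //; apply: mem_P => i; rewrite ellD pairZr.
have [|H _] := He e _ i (mem_enum _ i); first by rewrite e0 lexx.
have [iv|/tight_gt0] := boolP (i \in tight v); last by move/(_ Pv)/H/ltW.
by rewrite (tight0 iv) add0r mulr_ge0 ?Hy// ltW.
Qed.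

Lemma recession_trivial y : bounded_set P -> P !=set0 ->
  (forall i, 0 <= pair (u i) y) -> y = 0.
Proof.
move=> [M HM] [p Pp] Hy; apply/rowP => j; rewrite mxE; apply/eqP.
apply: contraT => yj.
have Pt t : 0 <= t -> P (p + t *: y).
  by move=> t0; apply: mem_P => i; rewrite ellD pairZr addr_ge0 ?P_ge0 ?mulr_ge0.
(* Chosen so that [t * y 0 j] has absolute value [|M| + |p 0 j| + 1], which pushes [p + t *: y] out
   of the bounding box. *)
pose t := (`|M| + `|p 0 j| + 1) / `|y 0 j|.
have t0 : 0 <= t by rewrite divr_ge0// !addr_ge0.
have /HM/(_ j) := Pt _ t0; rewrite !mxE => H.
have : `|t * y 0 j| <= M + `|p 0 j|.
  have -> : t * y 0 j = (p 0 j + t * y 0 j) - p 0 j by ring.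
  by apply: le_trans (ler_normB _ _) _; rewrite lerD2r.
rewrite normrM (ger0_norm t0) divfK ?normr_eq0// => H'.
by have := ler_norm M; lra.
Qed.

Hypothesis bP : bounded_set P.

(** From a point that is not a vertex, move along a direction that keeps the tight constraints and
    does not decrease [xi], until a new constraint becomes tight. The tight set grows strictly, so
    this stops. *)
Lemma exists_vertex_above xi p : P p ->
  exists v, [/\ is_vertex v, tight p \subset tight v & pair xi p <= pair xi v].
Proof.
have [n] := ubnP (N - #|tight p|); elim: n p => // n IH p np Pp.
have [vp|] := pselect (forall y, (forall i, i \in tight p -> pair (u i) y = 0) -> y = 0).
  by exists p; split.
move=> /existsNP[y0 /not_implyP[y0p y00]].
have [y [yp y1 xiy]] : exists y, [/\ forall i, i \in tight p -> pair (u i) y = 0,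
    y <> 0 & 0 <= pair xi y].
  have [?|/ltW ?] := leP 0 (pair xi y0); first by exists y0.
  exists (- y0); split=> [i /y0p|/eqP|]; rewrite ?pairNr ?oppr_ge0//.
    by move=> ->; rewrite oppr0.
  by rewrite oppr_eq0 => /eqP.
(* By boundedness some constraint must decrease along [y]. *)
have [i0 i0y] : exists i, pair (u i) y < 0.
  apply: contrapT => /forallNP H; apply: y1; apply: recession_trivial => //.
    by exists p.
  by move=> i; rewrite leNgt; apply/negP.
(* Ratio test: the least ratio is the time at which the first decreasing constraint reaches zero. *)
pose ratio i := ell i p / - pair (u i) y.
have [i iy imin] := @arg_minP _ _ _ i0 (fun i => pair (u i) y < 0) ratio i0y.
have ri : 0 <= ratio i by rewrite divr_ge0 ?P_ge0// oppr_ge0 ltW.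
pose p' := p + ratio i *: y.
have Pp' : P p'.
  apply: mem_P => j; rewrite ellD pairZr.
  have [jy|jy] := leP 0 (pair (u j) y).
    by apply: addr_ge0; [exact: P_ge0|exact: mulr_ge0].
  have := imin _ jy; rewrite [ratio j]/ratio ler_pdivlMr ?oppr_gt0// mulrN.
  by rewrite -subr_ge0 opprK.
have sub : tight p \proper tight p'.
  apply/fintype.properP; split.
    by apply/fintype.subsetP => j jp; rewrite inE ellD pairZr (yp _ jp) mulr0 addr0 (tight0 jp).
  exists i; last by apply/negP => /yp iy0; move: iy; rewrite iy0 ltxx.
  rewrite inE ellD pairZr /ratio invrN mulrN mulNr divfK ?subrr//.
  by rewrite lt_eqF.
have [||v [vv sv xv]] := IH p' => //.
  have := proper_card sub; have := max_card (mem (tight p')); rewrite card_ord.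
  move: np; rewrite ltnS => np H1 H2.
  by apply: leq_trans np; rewrite ltn_sub2l// (leq_trans H2).
exists v; split=> //; first exact: fintype.subset_trans (fintype.proper_sub sub) sv.
by apply: le_trans xv; rewrite pairDr pairZr lerDl mulr_ge0.
Qed.

(** The functional [- \sum_(i in I) u i] supports this face: its slack is the sum of the nonnegative
    [ell i x], which vanishes only if each of them does. *)
Lemma face_of_idx_is_face I : face_of_idx I !=set0 -> is_face u mu (face_of_idx I).
Proof.
move=> I0; split=> //; right.
have E x : pair (- \sum_(i in I) u i) x = \sum_(i in I) mu i - \sum_(i in I) ell i x.
  rewrite pairNl pair_suml -sumrB -sumrN; apply: eq_bigr => i _.
  by rewrite /Defs.ell; ring.
exists (- \sum_(i in I) u i), (\sum_(i in I) mu i); split.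
  by move=> x Px; rewrite E gerBl sumr_ge0// => i _; apply: P_ge0.
apply/seteqP; split=> x /= [Px H]; split=> //.
  by rewrite E [X in _ - X]big1 ?subr0// => i /H.
move: H; rewrite E => /(congr1 (fun z => \sum_(i in I) mu i - z)).
rewrite subKr subrr => /eqP.
rewrite psumr_eq0 => [/allP H i iI|i _]; last exact: P_ge0.
by have := H i (mem_index_enum _); rewrite iI => /eqP.
Qed.

(** * Edge bases at the vertices of a simple polytope *)

Hypothesis sP : simple_polytope u mu.

Lemma face_of_tight_vertex v : is_vertex v -> face_of_idx (tight v) = [set v].
Proof.
move=> [Pv vv]; apply/seteqP; split=> [x [Px H] /=|x /= ->].
  apply/eqP; rewrite -subr_eq0; apply/eqP/vv => i iv.
  by rewrite -ellB H// (tight0 iv) subrr.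
by apply/face_of_idx_tight.
Qed.

Lemma vertex_card v : is_vertex v -> #|tight v| = d.
Proof.
move=> vv; have Fv := face_of_tight_vertex _ vv.
have <- : Iof u mu [set v] = tight v.
  apply/finset.setP => i; rewrite !inE; apply/asboolP/eqP => [/(_ v erefl)[]//|iv x /= ->].
  by split=> //; case: vv.
apply: sP.
  by rewrite -Fv; apply: face_of_idx_is_face; rewrite Fv; exists v.
apply/eqP; rewrite -leqn0; apply/bigmax_leqP => k /asboolP[p0 [p [/= -> [Hp]]]].
have -> : \matrix_(j < k) (p j - v) = 0.
  by apply/matrixP => i j; rewrite mxE Hp subrr !mxE.
by rewrite /row_free mxrank0 eq_sym => /eqP ->.
Qed.

(** Dual basis vector to the tight normals at [v]: it leaves facet [i] inwards and stays on the
    other facets through [v], so it directs an edge. [dual_edgeP] shows that the default [0] is not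
    taken at a vertex with [i] tight. *)
Definition dual_edge (v : 'rV[R]_d) (i : 'I_N) : 'rV[R]_d :=
  xget 0 [set e | forall j, j \in tight v -> pair (u j) e = (j == i)%:R].

Lemma dual_edgeP {v i j} : is_vertex v -> i \in tight v -> j \in tight v ->
  pair (u j) (dual_edge v i) = (j == i)%:R.
Proof.
move=> vv iv; move: j.
suff : [set e | forall j, j \in tight v -> pair (u j) e = (j == i)%:R] (dual_edge v i) by [].
apply: xgetPex => /=.
pose U : 'M[R]_(#|tight v|, d) := \matrix_k u (enum_val k).
have rU k : row k U = u (enum_val k) by rewrite rowK.
have fU : row_free U^T.
  apply: inj_row_free => y yU; apply: (proj2 vv) => j jv.
  by rewrite -[j](enum_rankK_in jv)// -rU -mulmx_tr_pair yU mxE.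
(* The vertex condition gives [U] rank [d], and simplicity gives it exactly [d] rows, so the linear
   system for [e] is solvable. *)
have /submxP[e eU] : ((delta_mx 0 (enum_rank_in iv i) : 'rV_(#|tight v|)) <= U^T)%MS.
  by apply: submx_full; rewrite /row_full (eqP fU) (vertex_card _ vv).
exists e => j jv; rewrite -[j in LHS](enum_rankK_in iv jv) -rU -mulmx_tr_pair -eU mxE eqxx/=.
by rewrite -(inj_eq enum_val_inj) !enum_rankK_in.
Qed.

Lemma dual_edge_expand {v} x : is_vertex v ->
  x - v = \sum_(i in tight v) ell i x *: dual_edge v i.
Proof.
move=> vv; apply/eqP; rewrite -subr_eq0; apply/eqP/(proj2 vv) => j jv.
rewrite pairBr -ellB (tight0 jv) subr0 pair_sumr (bigD1 j)//= pairZr.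
rewrite dual_edgeP// eqxx mulr1 big1 ?addr0 ?subrr// => i /andP[iv ij].
by rewrite pairZr dual_edgeP// eq_sym (negPf ij) mulr0.
Qed.

Lemma pair_vertex_expand {v} xi x : is_vertex v ->
  pair xi x - pair xi v = \sum_(i in tight v) ell i x * pair xi (dual_edge v i).
Proof.
move=> vv; rewrite -pairBr (dual_edge_expand _ vv) pair_sumr.
by apply: eq_bigr => i _; rewrite pairZr.
Qed.

Lemma dual_edge_step {v i} : is_vertex v -> i \in tight v ->
  exists2 e : R, 0 < e &
    P (v + e *: dual_edge v i) /\ tight v :\ i \subset tight (v + e *: dual_edge v i).
Proof.
move=> vv iv; have [||e e0 He] := feasible_step v (dual_edge v i).
- by case: vv.
- by move=> j jv; rewrite dual_edgeP// ler0n.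
exists e => //; split=> //; apply/fintype.subsetP => j /setD1P[ji jv].
by rewrite inE ellD (tight0 jv) add0r pairZr dual_edgeP// (negPf ji) mulr0.
Qed.

(** For [i] tight at [v] but outside [I], a short step along edge [i] stays in the face and leaves
    facet [i]. *)
Lemma Iof_face_of_idx v (I : {set 'I_N}) : is_vertex v -> I \subset tight v ->
  Iof u mu (face_of_idx I) = I.
Proof.
move=> vv Iv; apply/finset.setP => i; rewrite inE; apply/asboolP/idP; last first.
  by move=> iI x [Px /(_ i iI)].
move=> H; have Fv : face_of_idx I v by apply/face_of_idx_tight; case: vv.
have iv : i \in tight v by have [_ /eqP] := H _ Fv; rewrite inE.
apply: contraT => iI; have [e e0 [Pe se]] := dual_edge_step vv iv.
have /H[_] : face_of_idx I (v + e *: dual_edge v i).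
  apply/face_of_idx_tight; split=> //; apply: fintype.subset_trans se.
  by rewrite finset.subsetD1 Iv.
rewrite ellD (tight0 iv) add0r pairZr dual_edgeP// eqxx mulr1 => e00.
by move: e0; rewrite e00 ltxx.
Qed.

Lemma affdim_face_of_idx v (I : {set 'I_N}) : is_vertex v -> I \subset tight v ->
  affdim (face_of_idx I) = (d - #|I|)%N.
Proof.
move=> vv Iv; apply/eqP; rewrite eqn_leq; apply/andP; split.
  apply/bigmax_leqP => k /asboolP[p0 [p [/face_of_idx_tight[P0 I0] [Hp fp]]]].
  (* Upper bound: differences of points of the face are annihilated by the normals in [I], which are
     independent because the edge directions give a one-sided inverse. *)
  pose A : 'M[R]_(#|I|, d) := \matrix_j u (enum_val j).
  have fA : row_full A^T.
    apply/row_fullP; exists (\matrix_j dual_edge v (enum_val j)).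
    apply/row_matrixP => i; rewrite row_mul rowK; apply/rowP => j.
    have Ii (k' : 'I_#|I|) : enum_val k' \in tight v.
      by apply: (fintype.subsetP Iv); apply: enum_valP.
    rewrite mulmx_tr_pair rowK dual_edgeP// !mxE (inj_eq enum_val_inj) eq_sym.
    by [].
  have /mulmx0_rank_max : (\matrix_(j < k) (p j - p0)) *m A^T = 0.
    apply/row_matrixP => j; rewrite row_mul rowK row0; apply/rowP => i.
    have iI := enum_valP i.
    have /face_of_idx_tight[_ Ij] := Hp j.
    rewrite mulmx_tr_pair rowK -ellB mxE (tight0 (fintype.subsetP I0 _ iI)).
    by rewrite (tight0 (fintype.subsetP Ij _ iI)) subrr.
  by rewrite (eqP fp) (eqP fA) leq_subRL -?(vertex_card _ vv) ?subset_leq_card// addnC.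
have -> : (d - #|I|)%N = #|tight v :\: I|.
  by rewrite cardsD (finset.setIidPr Iv) (vertex_card _ vv).
(* Lower bound: short steps from [v] along the edges indexed by [tight v :\: I] stay in the face and
   are independent. *)
set k := #|_|; have kd : (k < d.+1)%N.
  by rewrite ltnS -(vertex_card _ vv) subset_leq_card// finset.subsetDl.
apply: (leq_bigmax_cond (Ordinal kd)); apply/asboolP => /=.
have Dv (j : 'I_k) : enum_val j \in tight v by have := enum_valP j; rewrite inE => /andP[].
have /choice[e He] (j : 'I_k) : exists e : R, 0 < e /\
    face_of_idx I (v + e *: dual_edge v (enum_val j)).
  have [e e0 [Pe se]] := dual_edge_step vv (Dv j).
  exists e; split=> //; apply/face_of_idx_tight; split=> //.
  apply: fintype.subset_trans se; rewrite finset.subsetD1 Iv.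
  by have := enum_valP j; rewrite inE => /andP[].
exists v, (fun j => v + e j *: dual_edge v (enum_val j)); split.
  by apply/face_of_idx_tight; case: vv.
split=> [j|]; first by have [] := He j.
apply: inj_row_free => y y0; apply/rowP => j; rewrite mxE.
have /(congr1 (pair (u (enum_val j)))) := y0.
rewrite mulmx_sum_row pair_sumr pair0r (bigD1 j)//= big1 => [|i ij].
  rewrite addr0 rowK addrC addKr !pairZr dual_edgeP// eqxx mulr1 => /eqP.
  by rewrite mulf_eq0 (gt_eqF (He j).1) orbF => /eqP.
rewrite rowK addrC addKr !pairZr dual_edgeP// (inj_eq enum_val_inj) eq_sym.
by rewrite (negPf ij) !mulr0.
Qed.

(** * Vertices as index sets, and top vertices of faces *)

Lemma tight_inj {v v'} : is_vertex v -> is_vertex v' -> tight v = tight v' -> v = v'.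
Proof.
move=> vv vv' E; have : face_of_idx (tight v) v' by apply/face_of_idx_tight; rewrite E; case: vv'.
by rewrite face_of_tight_vertex.
Qed.

(** Vertices are named by their tight sets so that sums over them range over a finite type; [0] is a
    placeholder when [W] is no such set. *)
Definition vertex_at (W : {set 'I_N}) : 'rV[R]_d :=
  xget 0 [set v | is_vertex v /\ tight v = W].

Definition vertex_set (W : {set 'I_N}) : bool :=
  `[< exists v, is_vertex v /\ tight v = W >].

Lemma vertex_atP {W} : vertex_set W -> is_vertex (vertex_at W) /\ tight (vertex_at W) = W.
Proof. by move=> /asboolP vW; apply: (xgetPex 0 vW). Qed.

Lemma vertex_set_tight v : is_vertex v -> vertex_set (tight v).
Proof. by move=> vv; apply/asboolP; exists v. Qed.

Lemma vertex_at_tight v : is_vertex v -> vertex_at (tight v) = v.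
Proof.
by move=> vv; have [? ?] := vertex_atP (vertex_set_tight _ vv); apply: tight_inj.
Qed.

Definition ascents (xi v : 'rV[R]_d) : {set 'I_N} :=
  [set i in tight v | 0 < pair xi (dual_edge v i)]%SET.

Definition generic (xi : 'rV[R]_d) : Prop :=
  forall v i, is_vertex v -> i \in tight v -> pair xi (dual_edge v i) != 0.

Lemma in_ascents xi v i :
  (i \in ascents xi v) = (i \in tight v) && (0 < pair xi (dual_edge v i)).
Proof. by rewrite inE. Qed.

Lemma ascents_sub xi v : ascents xi v \subset tight v.
Proof. by apply/fintype.subsetP => i; rewrite inE => /andP[]. Qed.

(** Take a vertex of the face maximizing [xi]. An ascent outside [I] would give an edge inside the
    face along which [xi] increases, and then a better vertex by [exists_vertex_above]. *)
Lemma exists_top_vertex xi I : face_of_idx I !=set0 ->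
  exists v, [/\ is_vertex v, ascents xi v \subset I & I \subset tight v].
Proof.
move=> [p /face_of_idx_tight[Pp Ip]].
have [v0 [vv0 sv0 _]] := exists_vertex_above xi _ Pp.
pose Q W := vertex_set W && (I \subset W).
have Q0 : Q (tight v0) by rewrite /Q vertex_set_tight//= (fintype.subset_trans Ip).
have [W /andP[/vertex_atP[]]] := @arg_maxP _ _ _ (tight v0) Q (fun W => pair xi (vertex_at W)) Q0.
move: (vertex_at W) => v vv <-{W} Iv vmax; exists v; split=> //.
apply/fintype.subsetP => i; rewrite inE => /andP[iv xi0]; apply: contraT => iI.
have [e e0 [Pe se]] := dual_edge_step vv iv.
have [v' [vv' sv' xiv']] := exists_vertex_above xi _ Pe.
have : pair xi v' <= pair xi v.
  rewrite -(vertex_at_tight _ vv'); apply: vmax; rewrite /Q vertex_set_tight//=.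
  by apply: fintype.subset_trans sv'; apply: fintype.subset_trans se; rewrite finset.subsetD1 Iv.
rewrite leNgt (lt_le_trans _ xiv')// pairDr pairZr ltrDl.
exact: mulr_gt0.
Qed.

(** In the edge expansion of [pair xi p - pair xi v], an index tight at [p] contributes zero. Any
    other index is outside [I], hence no ascent, so by genericity its contribution is negative.
    Equality thus makes every index of [tight v] tight at [p]. *)
Lemma top_vertex_max {xi v} {I : {set 'I_N}} {p} : generic xi -> is_vertex v ->
  ascents xi v \subset I -> face_of_idx I p ->
  pair xi p <= pair xi v ?= iff (p == v).
Proof.
move=> gxi vv aI /face_of_idx_tight[Pp Ip].
have neg i : i \in tight v -> ell i p * pair xi (dual_edge v i) <= 0 ?= iff (ell i p == 0).
  move=> iv; have [ip|ip] := boolP (i \in tight p).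
    by rewrite (tight0 ip) mul0r eqxx; apply/leif_refl.
  have ip0 := tight_gt0 Pp ip; rewrite (gt_eqF ip0); apply/leifP.
  rewrite pmulr_rlt0// lt_neqAle gxi//= leNgt; apply: contra ip => xi0.
  by apply: (fintype.subsetP Ip); apply: (fintype.subsetP aI); rewrite inE iv.
split; first by rewrite -subr_le0 pair_vertex_expand// sumr_le0// => i /neg[].
apply/eqP/eqP => [|->//] E.
have : \sum_(i in tight v) - (ell i p * pair xi (dual_edge v i)) == 0.
  by rewrite sumrN -pair_vertex_expand// E subrr oppr0.
rewrite psumr_eq0 => [/allP H|i /neg[? _]]; last by rewrite oppr_ge0.
have : face_of_idx (tight v) p.
  apply/face_of_idx_tight; split=> //; apply/fintype.subsetP => i iv.
  have := H i (mem_index_enum _); rewrite iv oppr_eq0 implyTb.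
  by have [_ ->] := neg i iv; rewrite inE.
by rewrite face_of_tight_vertex.
Qed.

Lemma top_vertex_unique {xi} {I : {set 'I_N}} {v v'} : generic xi ->
  is_vertex v -> ascents xi v \subset I -> I \subset tight v ->
  is_vertex v' -> ascents xi v' \subset I -> I \subset tight v' -> v = v'.
Proof.
move=> gxi vv av Iv vv' av' Iv'.
have Fv : face_of_idx I v by apply/face_of_idx_tight; case: vv.
have Fv' : face_of_idx I v' by apply/face_of_idx_tight; case: vv'.
have [H1 H2] := top_vertex_max gxi vv av Fv'.
have [H3 _] := top_vertex_max gxi vv' av' Fv.
by apply/esym/eqP; rewrite -H2 eq_le H1.
Qed.

(** * Grouping the faces by their top vertex *)

Definition is_face_idx (I : {set 'I_N}) : bool :=
  `[< exists F, is_face u mu F /\ Iof u mu F = I >].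

(** By simplicity [Iof] recovers [I] from a nonempty [face_of_idx I], so summing over faces amounts
    to summing over these [I]. *)
Lemma is_face_idxP I : reflect (face_of_idx I !=set0) (is_face_idx I).
Proof.
apply: (iffP (asboolP _)) => [[F [[[p Fp] HF] <-]]|].
  have Pp : P p by case: HF Fp => [->//|[c [b [_ ->]]] []].
  by exists p; split=> // i; rewrite inE => /asboolP/(_ p Fp)[].
move=> I0; exists (face_of_idx I); split; first exact: face_of_idx_is_face.
(* Only some vertex of the face is wanted, so the zero functional serves. *)
by have [v [vv _ Iv]] := exists_top_vertex 0 _ I0; apply: Iof_face_of_idx Iv.
Qed.

Lemma sum_faces_by_top_vertex {A : nmodType} (xi : 'rV[R]_d) (f : {set 'I_N} -> A) :
  generic xi ->
  \sum_(I : {set 'I_N} | is_face_idx I) f I =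
  \sum_(W | vertex_set W)
    \sum_(I : {set 'I_N} | (ascents xi (vertex_at W) \subset I) && (I \subset W)) f I.
Proof.
move=> gxi.
pose tops (I : {set 'I_N}) :=
  [set v | [/\ is_vertex v, ascents xi v \subset I & I \subset tight v]].
pose top I := xget 0 (tops I).
have topP I : is_face_idx I -> tops I (top I).
  by move=> /is_face_idxP/(exists_top_vertex xi _) I0; apply: (xgetPex 0 I0).
rewrite (partition_big (tight \o top) vertex_set) => [|I /topP[vv _ _]]; last first.
  exact: vertex_set_tight.
apply: eq_bigr => W /vertex_atP[vv E]; apply: eq_bigl => I.
apply/andP/andP => [[/topP[tv tI It] /eqP tW]|[aI IW]].
  rewrite -tW It; split=> //; suff -> : vertex_at (tight (top I)) = top I by [].
  exact: vertex_at_tight.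
have FI : is_face_idx I.
  by apply/is_face_idxP; exists (vertex_at W); apply/face_of_idx_tight; rewrite E; case: vv.
split=> //=; have [tv tI It] := topP _ FI.
by rewrite (@top_vertex_unique xi I (top I) (vertex_at W)) ?E.
Qed.

Lemma exists_generic (x : 'rV[R]_d) (xi0 : 'rV[R]_d) :
  exists xi, [/\ generic xi,
    forall v i, is_vertex v -> i \in tight v ->
      0 < pair xi0 (dual_edge v i) -> 0 < pair xi (dual_edge v i) &
    forall v, is_vertex v -> 0 < pair xi0 (v - x) -> 0 < pair xi (v - x)].
Proof.
(* These finite lists contain all edge directions and all [v - x]; the entries for index sets that
   are not tight sets of vertices do no harm. *)
pose s1 := [seq dual_edge (vertex_at z.1) z.2 | z : {set 'I_N} * 'I_N].
pose s2 := [seq vertex_at W - x | W : {set 'I_N}].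
have [xi Hxi] := generic_perturbation (s1 ++ s2) xi0.
have ms1 v i : is_vertex v -> dual_edge v i \in s1 ++ s2.
  move=> vv; rewrite mem_cat; apply/orP; left.
  by apply/fintype.imageP; exists (tight v, i) => //=; rewrite vertex_at_tight.
have ms2 v : is_vertex v -> v - x \in s1 ++ s2.
  move=> vv; rewrite mem_cat; apply/orP; right.
  by apply/fintype.imageP; exists (tight v) => //=; rewrite vertex_at_tight.
exists xi; split=> [v i vv iv|v i vv iv|v vv].
- apply: (Hxi _ (ms1 v i vv)).1; apply/eqP => e0.
  by have /eqP := dual_edgeP vv iv iv; rewrite e0 pair0r eqxx eq_sym oner_eq0.
- exact: (Hxi _ (ms1 v i vv)).2.
- exact: (Hxi _ (ms2 v vv)).2.
Qed.

(** * The weighted identity *)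

Variable q : 'I_N -> complex R.

(** The value [0] outside the half-space absorbs the support condition, so [wchar] becomes a plain
    product and [sum_interval_prod] applies. *)
Definition local_weight (x : 'rV[R]_d) (i : 'I_N) : complex R :=
  if ell i x < 0 then 0 else if ell i x == 0 then q i else 1.

Lemma wchar_prod I x : wchar u mu q I x = \prod_(i in I) local_weight x i.
Proof.
rewrite /wchar; case: asboolP => [Ix|/existsNP[i /not_implyP[iI /negP]]].
  rewrite big_mkcondr; apply: eq_bigr => i iI; rewrite /local_weight ltNge.
  by rewrite Ix.
by rewrite -ltNge => ix; rewrite (bigD1 i)//= /local_weight ix mul0r.
Qed.

Hypothesis P0 : P !=set0.

Lemma brianchon_gram_weighted x :
  wcharP u mu q x =
  \sum_(I : {set 'I_N} | is_face_idx I) (-1) ^+ affdim (face_of_idx I) * wchar u mu q I x.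
Proof.
pose B : {set 'I_N} := [set i | ell i x <= 0]%SET.
have [xi [gxi xiE xiV]] := exists_generic x (\sum_(i in B) u i).
rewrite (sum_faces_by_top_vertex xi _ gxi).
pose w := local_weight x.
pose term v := \prod_(i in ascents xi v) w i * \prod_(i in tight v :\: ascents xi v) (w i - 1).
have -> : \sum_(W | vertex_set W)
    \sum_(I : {set 'I_N} | (ascents xi (vertex_at W) \subset I) && (I \subset W))
    (-1) ^+ affdim (face_of_idx I) * wchar u mu q I x =
    \sum_(W | vertex_set W) term (vertex_at W).
  apply: eq_bigr => W /vertex_atP[vv {2}<-]; rewrite /term -sum_interval_prod ?ascents_sub//.
  apply: eq_bigr => I /andP[_ Iv]; rewrite (affdim_face_of_idx _ _ vv Iv) wchar_prod.
  by rewrite cardsD (finset.setIidPr Iv) (vertex_card _ vv).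
(* On [B], [ell i x <= 0 <= ell i v], so the unperturbed functional is at least as large at [v] as
   at [x]. By [xiV] it cannot be strictly larger, which forces [ell i x = ell i v = 0] on all of
   [B]. *)
have low v : is_vertex v -> pair xi v <= pair xi x -> P x /\ tight x \subset tight v.
  move=> vv xv; have Pv : P v by case: vv.
  have : pair (\sum_(i in B) u i) (v - x) <= 0.
    rewrite leNgt; apply: contraTN xv => /(xiV _ vv).
    by rewrite pairBr subr_gt0 -ltNge.
  rewrite pair_suml.
  have nn i : i \in B -> 0 <= pair (u i) (v - x).
    by rewrite inE => ix; rewrite -ellB subr_ge0 (le_trans ix)// P_ge0.
  rewrite le_eqVlt ltNge sumr_ge0// orbF psumr_eq0// => /allP H.
  have Bx i : i \in B -> ell i x = 0 /\ ell i v = 0.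
    move=> iB; have := H i (mem_index_enum _); rewrite iB -ellB subr_eq0 => /eqP E.
    have xv0 : ell i x = 0.
      by apply/eqP; rewrite eq_le -{2}E P_ge0// andbT; move: iB; rewrite inE.
    by rewrite E.
  split.
    apply: mem_P => i; have [/ltW//|ix] := ltP 0 (ell i x).
    by have [|-> _] := Bx i; rewrite ?inE.
  apply/fintype.subsetP => i ix; rewrite inE.
  by have [|_ ->] := Bx i; rewrite ?inE ?(tight0 ix).
have termN0 v : is_vertex v -> term v != 0 ->
    (forall i, i \in ascents xi v -> 0 <= ell i x) /\
    (forall i, i \in tight v :\: ascents xi v -> ell i x <= 0).
  move=> vv; rewrite mulf_eq0 negb_or => /andP[/prodf_neq0 H1 /prodf_neq0 H2].
  split=> i => [/H1|/H2]; rewrite /w /local_weight.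
    by case: ltP => //; rewrite eqxx.
  by case: ltgtP => // _; rewrite subrr eqxx.
have termP v : is_vertex v -> term v != 0 ->
    [/\ P x, tight x \subset tight v & ascents xi v = tight v].
  move=> vv tv; have [H1 H2] := termN0 _ vv tv.
  have [|Px xv] := low v vv.
    rewrite -subr_ge0 pair_vertex_expand// sumr_ge0// => i iv.
    have [ia|ia] := boolP (i \in ascents xi v).
      by rewrite mulr_ge0 ?H1//; move: ia; rewrite inE => /andP[_ /ltW].
    rewrite mulr_le0 ?H2// ?finset.in_setD ?ia//.
    by move: ia; rewrite inE iv/= -leNgt.
  (* A non-ascent [i] would lie in [B], and [u i] pairs to 1 with edge [i]. The other members of [B]
     are tight at [x], hence at [v], and pair to 0 with it. So the unperturbed functional, and with
     it [xi], increases along edge [i]. *)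
  split=> //; apply/eqP; rewrite finset.eqEsubset ascents_sub; apply/fintype.subsetP => i iv.
  have [//|ia] := boolP (i \in ascents xi v).
  have ix : ell i x <= 0 by rewrite H2// finset.in_setD ia.
  apply: contraNT ia => _; rewrite in_ascents iv; apply: xiE => //.
  rewrite pair_suml (bigD1 i) ?inE//=.
  rewrite dual_edgeP// eqxx ltr_pwDl// sumr_ge0// => j /andP[jB ji].
  have jx : j \in tight x.
    by rewrite inE eq_le P_ge0// andbT; move: jB; rewrite inE.
  by rewrite (dual_edgeP vv iv (fintype.subsetP xv _ jx)) ler0n.
have [xP|xP] := pselect (P x); last first.
  rewrite /wcharP /wchar; case: asboolP => // _.
  rewrite big1// => W /vertex_atP[vv _]; apply/eqP; apply: contraT.
  by move=> /(termP _ vv)[].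
(* The [xi]-minimal vertex is the top vertex of the whole polytope for [- xi]. *)
have FT : face_of_idx finset.set0 !=set0 by case: P0 => p Pp; exists p; split=> // i; rewrite inE.
have gNxi : generic (- xi) by move=> v i vv iv; rewrite pairNl oppr_eq0 gxi.
have ascN v : is_vertex v -> (ascents (- xi) v \subset finset.set0) = (ascents xi v == tight v).
  move=> vv; rewrite finset.subset0; apply/eqP/eqP => E.
    apply/eqP; rewrite finset.eqEsubset ascents_sub; apply/fintype.subsetP => i iv.
    have : i \notin ascents (- xi) v by rewrite E finset.in_set0.
    rewrite !in_ascents iv pairNl oppr_gt0 -leNgt/=.
    by rewrite le_eqVlt eq_sym (negPf (gxi _ _ vv iv)).
  apply/finset.setP => i; rewrite finset.in_set0 in_ascents pairNl oppr_gt0.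
  by apply/negP => /andP[]; rewrite -E in_ascents => /andP[_ /lt_trans H /H]; rewrite ltxx.
have [v0 [vv0 a0 _]] := exists_top_vertex (- xi) _ FT.
have x0 : tight x \subset tight v0.
  have Fx : face_of_idx finset.set0 x by split=> // i; rewrite finset.in_set0.
  have [xv0 _] := top_vertex_max gNxi vv0 a0 Fx.
  by apply: (low v0 vv0 _).2; rewrite !pairNl lerN2 in xv0.
rewrite (bigD1 (tight v0)) ?vertex_set_tight//= vertex_at_tight// big1 ?addr0.
  have := a0; rewrite ascN// => /eqP E; rewrite /term E finset.setDv big_set0 mulr1.
  rewrite /wcharP wchar_prod [LHS](big_setID (tight v0))/= finset.setTI.
  (* Facets missing [v0] also miss [x], so their local weight is 1. *)
  rewrite [X in _ * X]big1 ?mulr1// => i; rewrite !inE andbT => iv.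
  have := tight_gt0 xP (contra (fintype.subsetP x0 i) _); rewrite inE => /(_ iv) ix.
  by rewrite /local_weight (lt_gtF ix) (gt_eqF ix).
(* A second vertex with nonzero term would also be a top vertex of [P] for [- xi]. *)
move=> W /andP[/vertex_atP[vv E] WN]; apply/eqP; apply: contraNT WN.
move=> /(termP _ vv)[_ _ /eqP]; rewrite -ascN// => aW.
rewrite -E; apply/eqP; congr tight.
exact: top_vertex_unique gNxi vv aW (finset.sub0set _) vv0 a0 (finset.sub0set _).
Qed.

End SimplePolytope.

Theorem mainTheorem1 (R : realType) (d N : nat)
  (u : 'I_N -> 'rV[R]_d) (mu : 'I_N -> R) (q : 'I_N -> complex R) :
  irredundant u mu ->
  bounded_set (P u mu) ->
  full_dim u mu ->
  simple_polytope u mu ->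
  forall x : 'rV[R]_d,
    wcharP u mu q x =
    \sum_(I : {set 'I_N} |
            `[< exists F, is_face u mu F /\ Iof u mu F = I >])
       (-1) ^+ affdim (face_of_idx u mu I) * wchar u mu q I x.
Proof. by move=> _ bP [P0 _] sP x; apply: brianchon_gram_weighted. Qed.
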